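(* For every natural number $n$ there exists a decomposition $[\mathsf{K}^c_n,P]$ of the complete convex geometric graph $\mathsf{K}^c_n$ such that \[\chi'([\mathsf{K}^c_n,P])\geq \frac{n^{2}}{9}-O(n).\]
   Context: $\mathsf{K}^c_n$ denotes the complete geometric graph whose $n$ vertices are points in convex position (the vertices of a convex polygon, e.g. a regular $n$-gon) and whose edges are all $\binom n2$ straight-line segments between them. A decomposition $[G,P]$ of a graph $G$ is a set $P$ of non-empty induced subgraphs of $G$ such that every edge of $G$ belongs to exactly one member of $P$; for $G=\mathsf{K}^c_n$ the members of $P$ are complete geometric subgraphs. Two geometric graphs have nonempty intersection if they share a vertex or some edge of one crosses some edge of the other. A $k$-$P$-coloring assigns to each edge one of $k$ colors so that all edges of each member of $P$ get the same color and any two members of $P$ with nonempty intersection get different colors; the chromatic index $\chi'([\mathsf{K}^c_n,P])$ is the least such $k$. *)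

(* Defs.v *)
From HB Require Import structures.
From mathcomp Require Import all_boot all_order all_algebra.
From mathcomp Require Import boolp classical_sets reals.

Set Implicit Arguments.
Unset Strict Implicit.
Unset Printing Implicit Defensive.
Import Order.TTheory GRing.Theory Num.Theory.
Local Open Scope ring_scope.

Section Decomposition.
Variables (V : finType) (g : rel V).

(* [g] is meant to be the (symmetric, irreflexive) adjacency relation of a
   simple graph on [V].  An edge is a 2-element set of vertices, and an induced
   subgraph is represented by its vertex set. *)
Definition edges_in (H : {set V}) : {set {set V}} :=
  [set [set x; y] | x in H, y in H & g x y].

Definition edges : {set {set V}} := edges_in [set: V].

Record decomposition := Decomposition {
  members :> {set {set V}};
  members_nonempty : forall H, H \in members -> H != finset.set0;
  members_edge : forall e, e \in edges ->
    exists! H, H \in members /\ e \in edges_in H }.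

Lemma edges_inW (H : {set V}) e : e \in edges_in H -> e \in edges.
Proof.
case/imset2P => x y xH /setIdP[yH gxy] ->.
by apply/imset2P; exists x y; rewrite ?inE.
Qed.

End Decomposition.

Section Geometric.
Variables (R : realType) (V : finType) (pos : V -> 'rV[R]_2).

(* No vertex lies in the convex hull of the others; this forces [pos] to be
   injective and no three vertices to be collinear. *)
Definition convex_position : Prop :=
  forall v : V, ~ exists w : V -> R,
    [/\ forall u, 0 <= w u, w v = 0, \sum_u w u = 1
      & pos v = \sum_u w u *: pos u].

Definition open_segment (e : {set V}) : set 'rV[R]_2 :=
  [set z | exists x y t, [/\ e = [set x; y]%SET, 0 < t < 1
                           & z = (1 - t) *: pos x + t *: pos y]]%classic.

Definition cross (e f : {set V}) : Prop :=
  e <> f /\ (exists z, open_segment e z /\ open_segment f z).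

Variable g : rel V.

Definition meets (H K : {set V}) : Prop :=
  (exists v, v \in H /\ v \in K) \/
  (exists e f, [/\ e \in edges_in g H, f \in edges_in g K & cross e f]).

(* Only the values of [c] on the edges of the graph matter. *)
Definition is_coloring (P : decomposition g) (k : nat) (c : {set V} -> nat) :
    Prop :=
  [/\ forall e, e \in edges g -> (c e < k)%N,
      forall H e f, H \in members P ->
        e \in edges_in g H -> f \in edges_in g H -> c e = c f
    & forall H K e f, H \in members P -> K \in members P -> H <> K ->
        meets H K -> e \in edges_in g H -> f \in edges_in g K -> c e <> c f].

Definition colorable (P : decomposition g) (k : nat) : Prop :=
  exists c, is_coloring P k c.

Lemma colorable_card (P : decomposition g) : colorable P #|{: {set V}}|.
Proof.
pose own e := odflt finset.set0
  [pick H | (H \in members P) && (e \in edges_in g H)].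
have ownE H e : H \in members P -> e \in edges_in g H -> own e = H.
  move=> HP eH; have [K [_ uK]] := members_edge P (edges_inW eH).
  rewrite /own; case: pickP => [L /andP[LP eL]|/(_ H)]; last by rewrite HP eH.
  by rewrite /= -(uK L) // -(uK H).
exists (fun e => nat_of_ord (enum_rank (own e))); split=> [e _|H e f HP eH fH|].
- exact: ltn_ord.
- by rewrite (ownE H e) // (ownE H f).
- move=> H K e f HP KP HK _ eH fK; rewrite (ownE H e) // (ownE K f) //.
  by move=> /ord_inj/enum_rank_inj.
Qed.

Lemma colorable_ex (P : decomposition g) : exists k, `[< colorable P k >].
Proof. by exists #|{: {set V}}|; apply/asboolP/colorable_card. Qed.

Definition chromatic_index (P : decomposition g) : nat :=
  ex_minn (colorable_ex P).

End Geometric.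

Definition complete_graph (V : finType) : rel V := fun x y => x != y.
Arguments complete_graph V x y : clear implicits.

(* Main.v *)
(** Cut the points, in cyclic order, into three arcs of [m = n %/ 3] points.  Two
    triangles having one vertex in each arc always intersect: if they share no
    vertex, then in two of the three arcs the second triangle comes on the same
    side of the first, and the edges joining those two arcs cross.  The Latin
    square [(i, j, i + j mod m)] gives [m ^ 2] such triangles, pairwise
    edge-disjoint; completed by single edges they form a decomposition, and they
    all need different colors. *)

Require Import Defs.
From mathcomp Require Import all_boot all_order all_algebra.
From mathcomp Require Import boolp reals.
From mathcomp Require Import zify ring lra.

Set Implicit Arguments.
Unset Strict Implicit.
Unset Printing Implicit Defensive.
Import Order.TTheory GRing.Theory Num.Theory.
Local Open Scope ring_scope.

(** * Completing a linear family of vertex sets to a decomposition *)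

Section LinearFamily.
Variable V : finType.
Local Notation K := (complete_graph V).

Lemma edges_in_completeP (H e : {set V}) :
  reflect (exists x y, [/\ x \in H, y \in H, x != y & e = [set x; y]])
          (e \in edges_in K H).
Proof.
apply: (iffP imset2P) => [[x y xH /setIdP[yH xy] ->]|[x [y [xH yH xy ->]]]].
  by exists x, y.
by exists x y; rewrite ?inE ?yH.
Qed.

Lemma edges_in_completeE (H e : {set V}) :
  (e \in edges_in K H) = (e \subset H) && (#|e| == 2).
Proof.
apply/edges_in_completeP/andP => [[x [y [xH yH xy ->]]]|[eH /cards2P[x [y [xy e_]]]]].
  by rewrite cards2 xy subUset !sub1set xH yH.
by exists x, y; move: eH; rewrite e_ subUset !sub1set => /andP[].
Qed.

(** Add to [F], as two-vertex members, the edges contained in no member of [F]. Linearity makes the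
    member covering an edge unique. *)
Lemma extend_linear_family (F : {set {set V}}) :
    (forall H, H \in F -> H != set0) ->
    (forall H H' x y, H \in F -> H' \in F -> x != y ->
       x \in H -> y \in H -> x \in H' -> y \in H' -> H = H') ->
  exists P : decomposition K, F \subset members P.
Proof.
move=> F0 linF.
pose G := [set e in edges K | [forall H in F, ~~ (e \subset H)]].
have ne H : H \in F :|: G -> H != set0.
  case/setUP => [/F0 //|]; rewrite inE edges_in_completeE -card_gt0.
  by case/andP => /andP[_ /eqP ->].
have ue e : e \in edges K -> exists! H, H \in F :|: G /\ e \in edges_in K H.
  move=> eE; have := eE; rewrite edges_in_completeE => /andP[_ e2].
  have [/exists_inP[H HF eH]|nF] := boolP [exists H in F, e \subset H].
    exists H; split; first by rewrite edges_in_completeE eH e2 inE HF.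
    move=> H' []; rewrite edges_in_completeE => + /andP[eH' _].
    case/setUP => [H'F|].
      have /cards2P[x [y [xy e_]]] := e2.
      move: eH eH'; rewrite e_ !subUset !sub1set => /andP[xH yH] /andP[xH' yH'].
      exact: (linF H H' x y).
    rewrite inE edges_in_completeE => /andP[/andP[_ c2] /forall_inP/(_ _ HF)].
    suff -> : H' = e by rewrite eH.
    by apply/esym/eqP; rewrite eqEcard eH' (eqP e2) (eqP c2).
  exists e; split.
    rewrite edges_in_completeE subxx e2; split=> //.
    by rewrite !inE eE -negb_exists_in nF orbT.
  move=> H' []; rewrite edges_in_completeE => + /andP[eH' _].
  case/setUP => [H'F|]; first by case/negP: nF; apply/exists_inP; exists H'.
  rewrite inE edges_in_completeE => /andP[/andP[_ c2] _].
  by apply/eqP; rewrite eqEcard eH' (eqP e2) (eqP c2).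
by exists (Decomposition ne ue); apply: subsetUl.
Qed.

End LinearFamily.

(** * Pairwise meeting members bound the chromatic index from below *)

Section Coloring.
Variables (R : realType) (V : finType) (pos : V -> 'rV[R]_2) (g : rel V).

(** Choose one edge in each member of [F]: the colors of the chosen edges are pairwise different. *)
Lemma card_meeting_le_chromatic_index (P : decomposition g) (F : {set {set V}}) :
    F \subset members P -> (forall H, H \in F -> edges_in g H != set0) ->
    (forall H K, H \in F -> K \in F -> meets pos g H K) ->
  (#|F| <= chromatic_index pos P)%N.
Proof.
move=> FP F0 Fm; rewrite /chromatic_index.
case: ex_minnP => k /asboolP[c [ck _ cP]] _.
pose ed (H : {set V}) := odflt set0 [pick e in edges_in g H].
have edP H : H \in F -> ed H \in edges_in g H.
  move=> /F0 /set0Pn[e eH]; rewrite /ed.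
  by case: pickP => [//|/(_ e)]; rewrite eH.
have cI : {in F &, injective (fun H => c (ed H))}.
  move=> H K HF KF /= cHK; apply/eqP/negPn/negP => /eqP HK.
  exact: (cP H K _ _ (subsetP FP _ HF) (subsetP FP _ KF) HK (Fm _ _ HF KF)
            (edP _ HF) (edP _ KF)).
have [->|[H0 H0F]] := set_0Vmem F; first by rewrite cards0.
(* Positivity lets [k] be written as a successor, so that [inord] can map colors into an ordinal
   type. *)
have k0 : (0 < k)%N.
  exact: leq_ltn_trans (leq0n _) (ck _ (edges_inW (edP _ H0F))).
case: k ck k0 => // k ck _.
rewrite -(card_in_imset (f := fun H => inord (c (ed H)) : 'I_k.+1) (D := F)).
  by rewrite -[leqRHS](card_ord k.+1) max_card.
move=> H K HF KF /(congr1 val); rewrite /= !inordK; first exact: cI.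
  exact/ck/edges_inW/edP.
exact/ck/edges_inW/edP.
Qed.

End Coloring.

(** * Orientations and the cyclic order of points in convex position *)

Section Convex.
Variables (R : realType) (V : finType) (pos : V -> 'rV[R]_2).

(** Twice the signed area of the triangle, positive when it runs counterclockwise. *)
Definition orient (a b c : V) : R :=
  (pos b 0 0 - pos a 0 0) * (pos c 0 1 - pos a 0 1)
  - (pos b 0 1 - pos a 0 1) * (pos c 0 0 - pos a 0 0).

Lemma row2P (u v : 'rV[R]_2) : u 0 0 = v 0 0 -> u 0 1 = v 0 1 -> u = v.
Proof.
move=> h0 h1; apply/rowP => i; case: i => [[|[|//]] lti].
  by rewrite (_ : Ordinal lti = 0) //; apply: val_inj.
by rewrite (_ : Ordinal lti = 1) //; apply: val_inj.
Qed.

(** The diagonals of a convex quadrilateral cross. Each is cut in the ratio of the areas of the two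
    triangles that its endpoints span with the other diagonal; [S] computes the area of the
    quadrilateral in two ways. *)
Lemma cross_of_orient (a b c d : V) :
    0 < orient a b c -> 0 < orient a b d -> 0 < orient a c d ->
    0 < orient b c d ->
  exists z, open_segment pos [set a; c] z /\ open_segment pos [set b; d] z.
Proof.
move=> abc abd acd bcd.
have S : orient b c d + orient a b d = orient a c d + orient a b c.
  by rewrite /orient; ring.
have ratio (x y : R) : 0 < x -> 0 < y -> 0 < x / (y + x) < 1.
  move=> x0 y0; have yx := addr_gt0 y0 x0.
  by rewrite divr_gt0 //= ltr_pdivrMr // mul1r ltrDr.
set t := orient a b d / (orient b c d + orient a b d).
exists ((1 - t) *: pos a + t *: pos c); split.
  exists a, c, t; split=> //.
  exact: ratio.
exists b, d, (orient a b c / (orient a c d + orient a b c)); split=> //.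
  exact: ratio.
have mix (x y p q : R) : 0 < x -> 0 < y ->
    (1 - x / (y + x)) * p + x / (y + x) * q = (y * p + x * q) / (y + x).
  by move=> x0 y0; field; rewrite gt_eqF ?addr_gt0.
by rewrite /t; apply: row2P; rewrite !mxE !mix // S; congr (_ / _);
  rewrite /orient; ring.
Qed.

Hypothesis cpos : convex_position pos.

(** Unnormalized weights let later lemmas refute configurations by polynomial identities between
    orientations. Repeated vertices among [a], [b], [c] are allowed, which covers segments and
    single points. *)
Lemma convex_position_triangle (v a b c : V) (x y z : R) :
    v != a -> v != b -> v != c ->
    0 <= x -> 0 <= y -> 0 <= z -> 0 < x + y + z ->
    (x + y + z) *: pos v = x *: pos a + y *: pos b + z *: pos c -> False.
Proof.
move=> va vb vc x0 y0 z0 s0 e; apply: (cpos (v := v)).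
pose s := x + y + z.
have sumD (T : lmodType R) (f : V -> T) (k : R) (p : V) :
    \sum_u (k * (u == p)%:R) *: f u = k *: f p.
  rewrite (bigD1 p) //= eqxx mulr1 big1 ?addr0 // => u /negPf ->.
  by rewrite mulr0 scale0r.
pose w u := (x * (u == a)%:R + y * (u == b)%:R + z * (u == c)%:R) / s.
have sumw (T : lmodType R) (f : V -> T) :
    \sum_u w u *: f u = s^-1 *: (x *: f a + y *: f b + z *: f c).
  rewrite -!sumD -!big_split scaler_sumr; apply: eq_bigr => u _ /=.
  by rewrite -!scalerDl scalerA mulrC.
exists w; split.
- by move=> u; rewrite divr_ge0 ?addr_ge0 ?mulr_ge0 // ltW.
- by rewrite /w (negPf va) (negPf vb) (negPf vc) !mulr0 !addr0 mul0r.
(* The total weight is the case of the constant function 1, with [R] as a module over itself. *)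
- have := sumw R^o (fun=> 1); rewrite /GRing.scale /=.
  under eq_bigr do rewrite mulr1; move=> ->.
  by rewrite !mulr1 mulVf // gt_eqF.
- by rewrite sumw -e scalerA mulVf ?scale1r // gt_eqF.
Qed.

(** Of three collinear points, one lies on the segment between the other two. With [u] and [v] the
    vectors from [a] to [b] and [c], collinearity gives [q u = d v], where [q] is the squared norm
    of [v] and [d] the inner product. *)
Lemma orient_neq0 (a b c : V) :
  a != b -> a != c -> b != c -> orient a b c != 0.
Proof.
move=> ab ac bc; apply/negP => /eqP o0.
pose u0 := pos b 0 0 - pos a 0 0; pose u1 := pos b 0 1 - pos a 0 1.
pose v0 := pos c 0 0 - pos a 0 0; pose v1 := pos c 0 1 - pos a 0 1.
have {}o0 : u0 * v1 = u1 * v0 by apply/eqP; rewrite -subr_eq0; apply/eqP.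
pose q := v0 * v0 + v1 * v1; pose d := u0 * v0 + u1 * v1.
have b0 : pos b 0 0 = pos a 0 0 + u0 by rewrite /u0; ring.
have b1 : pos b 0 1 = pos a 0 1 + u1 by rewrite /u1; ring.
have c0 : pos c 0 0 = pos a 0 0 + v0 by rewrite /v0; ring.
have c1 : pos c 0 1 = pos a 0 1 + v1 by rewrite /v1; ring.
have q0 : q * u0 = d * v0.
  transitivity (d * v0 + v1 * (u0 * v1 - u1 * v0)); first by rewrite /q /d; ring.
  by rewrite o0 subrr mulr0 addr0.
have q1 : q * u1 = d * v1.
  transitivity (d * v1 - v0 * (u0 * v1 - u1 * v0)); first by rewrite /q /d; ring.
  by rewrite o0 subrr mulr0 subr0.
have qge0 : 0 <= q by rewrite addr_ge0 // -expr2 sqr_ge0.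
have {qge0} qgt0 : 0 < q.
  rewrite lt_neqAle qge0 andbT; apply/negP => /eqP/esym/eqP.
  rewrite paddr_eq0 -?expr2 ?sqr_ge0 // !sqrf_eq0 => /andP[/eqP v00 /eqP v10].
  apply: (@convex_position_triangle a c c c 1 0 0 ac ac ac); [lra..|].
  by apply: row2P; rewrite !mxE ?c0 ?c1 ?v00 ?v10; ring.
(* The position of [d] relative to 0 and [q] tells which point is in the middle: [a], then [b], then
   [c]. *)
have [d0|d0] := lerP d 0.
  apply: (@convex_position_triangle a b c c q (- d) 0 ab ac ac); [lra..|].
  by apply: row2P; rewrite !mxE ?b0 ?b1 ?c0 ?c1; lra.
have [dq|dq] := lerP d q.
  apply: (@convex_position_triangle b a c c (q - d) d 0 _ bc bc); [|lra..|].
    by rewrite eq_sym.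
  by apply: row2P; rewrite !mxE ?b0 ?b1 ?c0 ?c1; lra.
apply: (@convex_position_triangle c a b b (d - q) q 0); rewrite 1?eq_sym //; [lra..|].
by apply: row2P; rewrite !mxE ?b0 ?b1 ?c0 ?c1; lra.
Qed.

Lemma orient_opp a b c : orient a c b = - orient a b c.
Proof. by rewrite /orient; ring. Qed.

(* Otherwise [p] would lie in the triangle [x y z]. *)
Lemma orient_trans p x y z : x != p -> y != p -> z != p ->
  0 <= orient p x y -> 0 <= orient p y z -> 0 <= orient p x z.
Proof.
move=> xp yp zp xy yz; rewrite leNgt; apply/negP => xz.
apply: (@convex_position_triangle p x y z
  (orient p y z) (- orient p x z) (orient p x y)); rewrite 1?eq_sym //; [lra..|].
by apply: row2P; rewrite !mxE /orient; ring.
Qed.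

(* Otherwise [y] would lie in the triangle [p x z]. *)
Lemma orient_gt0_from p x y z : y != p -> x != y -> y != z ->
  0 < orient p x y -> 0 < orient p y z -> 0 < orient x y z.
Proof.
move=> yp xy yz pxy pyz; rewrite ltNge; apply/negP => xyz.
apply: (@convex_position_triangle y p x z
  (- orient x y z) (orient p y z) (orient p x y)) => //; [|lra..|].
  by rewrite eq_sym.
by apply: row2P; rewrite !mxE /orient; ring.
Qed.

(** Numbers the points counterclockwise from 0; from here on the geometry enters only through the
    orientation of triples of increasing rank. *)
Lemma cyclic_rank : exists r : V -> nat,
  [/\ injective r, forall k, (k < #|V|)%N -> exists v, r v = k
    & forall a b c, (r a < r b < r c)%N -> 0 < orient a b c].
Proof.
have [p _|V0] := pickP (xpredT : pred V); last first.
  exists (fun=> 0%N); split=> [x|k|x]; try by have := V0 x.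
  by rewrite eq_card0.
(* [p] is extreme, so the other points are sorted by their angle around [p]. *)
pose le x y := 0 <= orient p x y.
pose s := sort le [seq v <- enum V | v != p].
have sp v : (v \in s) = (v != p) by rewrite mem_sort mem_filter mem_enum andbT.
have us : uniq (p :: s).
  by rewrite /= sp eqxx sort_uniq filter_uniq ?enum_uniq.
have ms v : v \in p :: s by rewrite inE sp orbN.
have ss : size (p :: s) = #|V|.
  by rewrite -(card_uniqP us); apply: eq_card => v; rewrite ms.
(* [le] is known to be transitive only away from [p], hence the relative form of the sorting
   lemma. *)
have pw : pairwise le s.
  rewrite -(@sorted_pairwise_in _ [pred v | v != p]).
  - apply: sort_sorted => x y; rewrite /le orient_opp oppr_ge0.
    exact: le_total.
  - move=> y x z yp xp zp; exact: orient_trans.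
  - by apply/allP => v; rewrite sp.
pose r v := index v (p :: s).
have rI : injective r.
  by move=> x y rxy; rewrite -(nth_index p (ms x)) -/(r x) rxy nth_index.
have r0 v : (0 < r v)%N = (v != p).
  by rewrite /r /= eq_sym; case: eqVneq.
(* The sort gives only a weak inequality; it is strict because no three points are collinear. *)
have rp x y : (0 < r x)%N -> (r x < r y)%N -> 0 < orient p x y.
  move=> x0 xy; have y0 := ltn_trans x0 xy.
  rewrite lt0r orient_neq0 /=; first last.
  - by apply/eqP => exy; move: xy; rewrite exy ltnn.
  - by rewrite eq_sym -r0.
  - by rewrite eq_sym -r0.
  have rE v : (0 < r v)%N -> r v = (index v s).+1.
    by rewrite r0 /r /= eq_sym => /negPf ->.
  have /pairwiseP -/(_ p) h := pw.
  have xs : x \in s by rewrite sp -r0.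
  have ys : y \in s by rewrite sp -r0.
  have := h (index x s) (index y s); rewrite !nth_index //; apply.
  - by rewrite inE index_mem.
  - by rewrite inE index_mem.
  - by move: xy; rewrite (rE x x0) (rE y y0).
exists r; split=> // [k kV|a b c /andP[ab bc]].
  by exists (nth p (p :: s) k); rewrite /r index_uniq // ss.
have b0 := leq_ltn_trans (leq0n _) ab.
have c0 := ltn_trans b0 bc.
have [a0|] := posnP (r a).
  suff -> : a = p by apply: rp.
  by apply/eqP; rewrite -[_ == _]negbK -r0 a0.
move=> a0; apply: (@orient_gt0_from p); rewrite -?r0 //; try exact: rp.
  by apply/eqP => e; move: ab; rewrite e ltnn.
by apply/eqP => e; move: bc; rewrite e ltnn.
Qed.

End Convex.

(** * Latin-square triangles and their linearity *)

Section LatinTriangles.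
Variables (V : finType) (m : nat) (r : V -> nat).
Hypothesis rI : injective r.
Hypothesis rV : forall k, (k < 3 * m)%N -> exists v, r v = k.

Definition latin_triangle (p : 'I_m * 'I_m) : {set V} :=
  [set v | [|| r v == p.1, r v == m + p.2
             | r v == 2 * m + (p.1 + p.2) %% m]%N].

Lemma latin_triangleP p : exists a b c,
  [/\ [/\ a \in latin_triangle p, b \in latin_triangle p & c \in latin_triangle p],
      r a = p.1, r b = (m + p.2)%N & r c = (2 * m + (p.1 + p.2) %% m)%N].
Proof.
case: p => i j; have [im jm] := (ltn_ord i, ltn_ord j).
have k_m : ((i + j) %% m < m)%N by rewrite ltn_mod; lia.
have [a ra] : exists v, r v = i by apply: rV; lia.
have [b rb] : exists v, r v = (m + j)%N by apply: rV; lia.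
have [c rc] : exists v, r v = (2 * m + (i + j) %% m)%N by apply: rV; lia.
by exists a, b, c; split=> //; split; rewrite inE ?ra ?rb ?rc eqxx ?orbT.
Qed.

(** Distinct vertices of a triangle lie in different arcs, so they fix two of row, column and
    symbol, and these determine the cell of the Latin square. *)
Lemma latin_triangle_linear p p' x y : x != y ->
    x \in latin_triangle p -> y \in latin_triangle p ->
    x \in latin_triangle p' -> y \in latin_triangle p' -> p = p'.
Proof.
case: p p' => [i j] [i' j'] xy; rewrite !inE /=.
have rxy : r x <> r y by move/rI/eqP; apply/negP.
have [im jm] := (ltn_ord i, ltn_ord j).
have [im' jm'] := (ltn_ord i', ltn_ord j').
have km : ((i + j) %% m < m)%N by rewrite ltn_mod; lia.
have km' : ((i' + j') %% m < m)%N by rewrite ltn_mod; lia.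
have h1 : (i : nat) = i' -> ((i + j) %% m = (i' + j') %% m)%N -> (j : nat) = j'.
  by move=> <- /eqP; rewrite eqn_modDl !modn_small // => /eqP.
have h2 : (j : nat) = j' -> ((i + j) %% m = (i' + j') %% m)%N -> (i : nat) = i'.
  by move=> <- /eqP; rewrite eqn_modDr !modn_small // => /eqP.
(* [h1] and [h2] carry all that is needed of the residues; abstracting them leaves a linear problem
   for [lia]. *)
move: ((i + j) %% m)%N ((i' + j') %% m)%N km km' h1 h2 => k k' km km' h1 h2.
move=> xp yp xp' yp'.
suff [e1 e2] : (i : nat) = i' /\ (j : nat) = j' by congr (_, _); apply: val_inj.
by move: (r x) (r y) rxy xp yp xp' yp' => a b; lia.
Qed.

Lemma latin_triangle_inj : injective latin_triangle.
Proof.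
move=> p p' e; have [a [b [_ [[ap bp _] ra rb _]]]] := latin_triangleP p.
apply: (@latin_triangle_linear _ _ a b) => //; rewrite -?e //.
have := ltn_ord p.1; apply: contraTneq => ab.
by move: rb; rewrite -ab ra => ->; lia.
Qed.

End LatinTriangles.

(** * Crossings between triangles and the quadratic bound *)

Lemma meets_of_alternating (R : realType) (V : finType) (pos : V -> 'rV[R]_2)
    (r : V -> nat) (H K : {set V}) (a b c d : V) :
    (forall x y z, (r x < r y < r z)%N -> 0 < orient pos x y z) ->
    a \in H -> c \in H -> b \in K -> d \in K -> (r a < r b < r c)%N ->
    (r c < r d)%N ->
  meets pos (complete_graph V) H K /\ meets pos (complete_graph V) K H.
Proof.
move=> rO aH cH bK dK /andP[ab bc] cd.
have neq x y : (r x < r y)%N -> x != y by apply: contraTneq => ->; rewrite ltnn.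
have ac := ltn_trans ab bc; have bd := ltn_trans bc cd.
have [||||z [z1 z2]] := @cross_of_orient _ _ pos a b c d; try apply: rO;
  rewrite ?ab ?bc ?ac ?bd //.
have eH : [set a; c] \in edges_in (complete_graph V) H.
  by apply/edges_in_completeP; exists a, c; rewrite neq.
have eK : [set b; d] \in edges_in (complete_graph V) K.
  by apply/edges_in_completeP; exists b, d; rewrite neq.
have ef : [set a; c] <> [set b; d].
  move=> /setP/(_ a); rewrite !inE eqxx /= => /esym/orP[] /eqP e.
    by move: ab; rewrite e ltnn.
  by move: (ltn_trans ab bd); rewrite e ltnn.
split; right; first by exists [set a; c], [set b; d]; do 2?split=> //; exists z.
exists [set b; d], [set a; c]; split=> //; split; first exact: nesym.
by exists z.
Qed.

Lemma meets_latin_triangle (R : realType) (V : finType) (pos : V -> 'rV[R]_2)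
    (r : V -> nat) (m : nat) (p p' : 'I_m * 'I_m) :
    (forall k, (k < 3 * m)%N -> exists v, r v = k) -> injective r ->
    (forall x y z, (r x < r y < r z)%N -> 0 < orient pos x y z) ->
  meets pos (complete_graph V) (latin_triangle r p) (latin_triangle r p').
Proof.
move=> rV rI rO.
have [a [b [c [[aH bH cH] ra rb rc]]]] := latin_triangleP rV p.
have [a' [b' [c' [[aK bK cK] ra' rb' rc']]]] := latin_triangleP rV p'.
move: (latin_triangle r p) (latin_triangle r p') aH bH cH aK bK cK
  => H K aH bH cH aK bK cK.
have [i1 i2] := (ltn_ord p.1, ltn_ord p.2).
have [j1 j2] := (ltn_ord p'.1, ltn_ord p'.2).
have i3 : ((p.1 + p.2) %% m < m)%N by rewrite ltn_mod; lia.
have j3 : ((p'.1 + p'.2) %% m < m)%N by rewrite ltn_mod; lia.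
(* Two arcs compared the same way: either a vertex is shared, or the four endpoints alternate and
   the chords cross. *)
have arcs x y x' y' : x \in H -> y \in H -> x' \in K -> y' \in K ->
    (r x < r y)%N -> (r x < r y')%N -> (r x' < r y)%N -> (r x' < r y')%N ->
    (r x < r x')%N = (r y < r y')%N -> meets pos (complete_graph V) H K.
  move=> xH yH xK yK xy xy' x'y x'y'.
  case: (ltngtP (r x) (r x')) => [xx'|xx'|/rI e _]; last first.
  - by left; exists x; rewrite {2}e.
  - case: (ltngtP (r y) (r y')) => [//|yy'|/rI e _].
      by case: (meets_of_alternating rO xK yK xH yH _ yy'); rewrite // xx'.
    by left; exists y; rewrite {2}e.
  - move/esym => yy'.
    by case: (meets_of_alternating rO xH yH xK yK _ yy'); rewrite // xx'.
(* Of three booleans two agree; if the first differs from both others, those two are equal. *)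
case: (boolP ((r a < r a')%N == (r b < r b')%N)) => [/eqP|] eab.
  by apply: (arcs a b a' b') => //; lia.
case: (boolP ((r a < r a')%N == (r c < r c')%N)) => [/eqP|] eac.
  by apply: (arcs a c a' c') => //; lia.
by apply: (arcs b c b' c') => //; lia.
Qed.

Theorem theorem3p1 (R : realType) :
  exists C : R, forall (n : nat) (pos : 'I_n -> 'rV[R]_2),
    convex_position pos ->
    exists P : decomposition (complete_graph 'I_n),
      n%:R ^+ 2 / 9%:R - C * n%:R <= (chromatic_index pos P)%:R.
Proof.
exists 1 => n pos /cyclic_rank[r [rI rV rO]].
pose m := (n %/ 3)%N.
have {}rV k : (k < 3 * m)%N -> exists v, r v = k.
  by move=> km; apply: rV; rewrite card_ord /m in km *; lia.
pose F := [set latin_triangle r p | p : 'I_m * 'I_m].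
have [_ /imsetP[p _ ->]|_ _ x y /imsetP[p _ ->] /imsetP[q _ ->] xy xp yp xq yq|P FP] :=
  @extend_linear_family 'I_n F.
- by have [a [_ [_ [[ap _ _] _ _ _]]]] := latin_triangleP rV p; apply/set0Pn; exists a.
- by rewrite (latin_triangle_linear rI xy xp yp xq yq).
exists P; have : (m * m <= chromatic_index pos P)%N.
  have -> : (m * m)%N = #|F|.
    by rewrite card_imset ?card_prod ?card_ord //; apply: latin_triangle_inj.
  apply: card_meeting_le_chromatic_index => // [_ /imsetP[p _ ->]|].
    have [a [b [_ [[ap bp _] ra rb _]]]] := latin_triangleP rV p.
    apply/set0Pn; exists [set a; b]; apply/edges_in_completeP; exists a, b.
    split=> //; apply/eqP => ab; move: rb; rewrite -ab ra.
    by move=> e; move: (ltn_ord p.1); rewrite e ltnNge leq_addr.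
  by move=> _ _ /imsetP[p _ ->] /imsetP[q _ ->]; apply: meets_latin_triangle.
(* With [s = n - 3m <= 2], the difference [n^2 - 9m^2 = s(2n - s)] is at most [4n]; rounding up to
   [9n] gives the constant 1 after division by 9. *)
have : (n * n <= 9 * (m * m) + 9 * n)%N by rewrite /m; nia.
rewrite -!(ler_nat R) !(natrD, natrM) => h1 h2.
by rewrite mul1r expr2; lra.
Qed.
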